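(* Let $\bar G=(V,E)$ be a rooted digraph with a self-loop at each vertex. Let $V_1,\ldots,V_q$ be the relevant subsets of $\bar G$. Let $\overline{W}$ be the subset of $\operatorname{Sp}[V]$ comprised of the vectors $w$ for which $\bar{\mathbb{A}}_{\bar G}(w)$ is nonempty. Then $$\overline{W}=\bigcup_{i=1}^q\operatorname{Sp}(V_i).$$
   Context: $\bar G$ is a finite digraph on $V=\{1,\ldots,n\}$ with at most one edge for each ordered pair of vertices and with $i\to i\in E$ for all $i\in V$. A vertex $r$ is a root if for every $i\in V$ there is a (directed) path from $i$ to $r$; the digraph is rooted if it contains a root. $V_r\subset V$ denotes the set of all roots. A digraph is strongly connected if for every ordered pair $(i,j)$ of vertices there is a path from $i$ to $j$ (a one-vertex graph is strongly connected). The subgraph induced by $V'\subset V$ has vertex set $V'$ and all edges with both endpoints in $V'$. Relevant subset: $V'\subset V$ is relevant if (a) $V'\subset V_r$, and (b) the subgraph induced by $V'$ is strongly connected. With $e_1,\ldots,e_n$ the standard basis of $\mathbb{R}^n$ and $V'\subset V$, $\operatorname{Sp}[V']=\{\sum_{i\in V'}\alpha_ie_i\mid \alpha_i\ge 0,\ \sum_{i\in V'}\alpha_i=1\}$ and $\operatorname{Sp}(V')=\{\sum_{i\in V'}\alpha_ie_i\mid \alpha_i> 0,\ \sum_{i\in V'}\alpha_i=1\}$. A stochastic matrix is a real square matrix with non-negative entries whose rows each sum to one. $\bar{\mathbb{A}}_{\bar G}$ is the set of $n\times n$ stochastic matrices whose $ij$-th entry is zero whenever $i\to j$ is not an edge of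 $\bar G$ (diagonal entries are allowed to be positive since all self-loops are present). For $w\in\operatorname{Sp}[V]$, $\bar{\mathbb{A}}_{\bar G}(w)$ is the set of $\bar A\in\bar{\mathbb{A}}_{\bar G}$ such that $1$ is a simple eigenvalue of $\bar A$ and $\bar A^\top w=w$. *)

(* Defs.v *)
From mathcomp Require Import all_boot all_order all_algebra.
From mathcomp Require Import classical_sets reals.

Set Implicit Arguments.
Unset Strict Implicit.
Unset Printing Implicit Defensive.

Import Order.TTheory GRing.Theory Num.Theory.
Local Open Scope classical_set_scope.
Local Open Scope ring_scope.

(* A digraph on a finite vertex type T is its edge relation e : rel T, and
   [connect e i j] says that there is a directed path (possibly of length 0)
   from i to j. *)

Definition roots_set (T : finType) (e : rel T) : {set T} :=
  [set r : T | [forall i, connect e i r]]%SET.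

Definition rooted (T : finType) (e : rel T) : Prop :=
  exists r : T, r \in roots_set e.

Definition strongly_connected (T : finType) (e : rel T) : Prop :=
  forall i j : T, connect e i j.

Definition induced (T : finType) (e : rel T) (S : {set T}) :
    rel {x : T | x \in S} :=
  fun i j => e (val i) (val j).

(* The empty set is relevant under this definition; it is harmless, as
   [Sp_open set0] is empty. *)
Definition relevant (T : finType) (e : rel T) (S : {set T}) : Prop :=
  S \subset roots_set e /\ strongly_connected (@induced T e S).

Section Simplices.
Context {R : realType} {n : nat}.

Definition Sp_closed (S : {set 'I_n}) : set 'cV[R]_n :=
  [set w | exists a : 'I_n -> R,
    [/\ forall i, i \in S -> 0 <= a i,
        \sum_(i in S) a i = 1 &
        w = \sum_(i in S) a i *: delta_mx i 0] ].

Definition Sp_open (S : {set 'I_n}) : set 'cV[R]_n :=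
  [set w | exists a : 'I_n -> R,
    [/\ forall i, i \in S -> 0 < a i,
        \sum_(i in S) a i = 1 &
        w = \sum_(i in S) a i *: delta_mx i 0] ].

End Simplices.

Section StochasticMatrices.
Context {R : realType} {n : nat}.

Definition stochastic (A : 'M[R]_n) : Prop :=
  (forall i j, 0 <= A i j) /\ (forall i, \sum_j A i j = 1).

(* Simplicity is algebraic: l has multiplicity one as a root of the
   characteristic polynomial. *)
Definition simple_eigenvalue (A : 'M[R]_n) (l : R) : Prop :=
  mup l (char_poly A) = 1%N.

Definition graph_stochastic (e : rel 'I_n) : set 'M[R]_n :=
  [set A | stochastic A /\ forall i j, ~~ e i j -> A i j = 0].

Definition graph_stochastic_at (e : rel 'I_n) (w : 'cV[R]_n) : set 'M[R]_n :=
  [set A | [/\ graph_stochastic e A, simple_eigenvalue A 1 & A^T *m w = w] ].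

Definition attainable_weights (e : rel 'I_n) : set 'cV[R]_n :=
  [set w | Sp_closed [set: 'I_n]%SET w /\ graph_stochastic_at e w !=set0].

End StochasticMatrices.

(* Main.v *)
Require Import Defs.
From mathcomp Require Import all_boot all_order all_algebra.
From mathcomp Require Import classical_sets reals.
From mathcomp Require Import ring.
Set Implicit Arguments.
Unset Strict Implicit.
Unset Printing Implicit Defensive.

Import Order.TTheory GRing.Theory Num.Theory.
Local Open Scope classical_set_scope.
Local Open Scope ring_scope.

(* For a matrix [A] with unit row sums, Cramer's rule shows that 1 is a simple
   eigenvalue iff [1 - A], with one column replaced by ones, is invertible.
   If it is, the stationary weight [w] is unique up to scaling; the set of
   vertices reachable from [i] in the graph of [A] is closed, so it carries a
   nonzero stationary vector, hence it contains the support of [w]: every vertex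
   reaches every vertex of the support, which is closed and so relevant.
   Conversely, let [S] be relevant and walk uniformly along the edges that do
   not leave [S]. This walk has a stationary weight positive exactly on [S],
   which changes of speed on [S] turn into any prescribed such weight. Every
   vertex still reaches [S], so by the maximum principle the harmonic functions
   are the constants, which gives simplicity. *)

(** * Simplicity of the eigenvalue 1 as invertibility *)

Definition ones_col {R : pzRingType} {n} (r : 'I_n) (M : 'M[R]_n) : 'M[R]_n :=
  \matrix_(i, j) if j == r then 1 else M i j.

(* Row [r] of [\adj M *m M = (\det M)%:M], summed over its columns. *)
Lemma det_const_row_sum (R : comPzRingType) n (M : 'M[R]_n) (r : 'I_n) (s : R) :
  (forall i, \sum_j M i j = s) -> \det M = \det (ones_col r M) * s.
Proof.
move=> Ms.
have <- : \sum_j (\adj M *m M) r j = \det M.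
  rewrite mul_adj_mx (bigD1 r) //= mxE eqxx big1 ?addr0 // => j jr.
  by rewrite mxE eq_sym (negPf jr).
under eq_bigr => j _ do rewrite mxE.
rewrite exchange_big /= (expand_det_col _ r) mulr_suml.
apply: eq_bigr => k _; rewrite -mulr_sumr Ms !mxE eqxx mul1r.
congr (_ * \det _ * _); apply/matrixP => i j.
by rewrite !mxE eq_sym (negPf (neq_lift _ _)).
Qed.

(** All row sums of [char_poly_mx A] are ['X - 1], so [char_poly A] is ['X - 1] times a determinant
    whose value at 1 is that of [ones_col r (1%:M - A)]. Multiplicity one means that this value is
    nonzero. *)
Lemma simple_eigenvalue1P (R : realType) n (A : 'M[R]_n) (r : 'I_n) :
  (forall i, \sum_j A i j = 1) ->
  simple_eigenvalue A 1 <-> ones_col r (1%:M - A) \in unitmx.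
Proof.
move=> A1; rewrite /simple_eigenvalue.
have chE : char_poly A = \det (ones_col r (char_poly_mx A)) * ('X - 1%:P).
  apply: det_const_row_sum => i.
  rewrite -(A1 i) (raddf_sum polyC) (bigD1 i) //= [in RHS](bigD1 i) //=.
  rewrite !mxE eqxx opprD addrA; congr (_ + _).
  by rewrite -sumrN; apply: eq_bigr => j ji; rewrite !mxE eq_sym (negPf ji) sub0r.
have qE : (\det (ones_col r (char_poly_mx A))).[1] = \det (ones_col r (1%:M - A)).
  rewrite -[LHS]/(horner_eval 1 _) -det_map_mx; congr (\det _); apply/matrixP => i j.
  rewrite !mxE; case: ifP => _; rewrite /= horner_evalE ?hornerC //.
  by rewrite !hornerE; case: (i == j); rewrite ?mulr1n ?mulr0n !hornerE.
have nz : char_poly A != 0.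
  by rewrite -lead_coef_eq0 (monicP (char_poly_monic A)) oner_neq0.
move: nz; rewrite unitmxE unitfE -qE chE mulf_eq0 negb_or => /andP[q0 X0].
have mX : mup 1 ('X - 1%:P : {poly R}) = 1%N.
  by rewrite -['X - _]expr1 mup_XsubCX eqxx.
rewrite mupM // mX; split => [|q1].
  rewrite addn1 => -[m0]; move: (XsubC_dvd 1 q0); rewrite m0 ltnn dvdp_XsubCl.
  by move/negbT.
by rewrite mupNroot.
Qed.

(** * Stationary vectors *)

Lemma stationaryP (R : pzSemiRingType) n (A : 'M[R]_n) (v : 'cV[R]_n) :
  A^T *m v = v <-> forall j, \sum_i A i j * v i 0 = v j 0.
Proof.
split=> [Av j|Av].
  by rewrite -[in RHS]Av mxE; apply: eq_bigr => i _; rewrite mxE.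
apply/matrixP => j k; rewrite ord1 -Av mxE.
by apply: eq_bigr => i _; rewrite mxE.
Qed.

(** The difference [v - c *: w] is stationary with coordinate sum zero. The transpose of
    [ones_col r (1%:M - A)] kills it: row [r] computes the sum, the other rows express
    stationarity. *)
Lemma simple_stationary_unique (R : realType) n (A : 'M[R]_n) (v w : 'cV[R]_n) :
  (forall i, \sum_j A i j = 1) -> simple_eigenvalue A 1 ->
  A^T *m w = w -> \sum_i w i 0 = 1 -> A^T *m v = v ->
  v = (\sum_i v i 0) *: w.
Proof.
move=> A1 simA Aw w1 Av.
apply/matrixP => r k; rewrite ord1 {k}.
have /(simple_eigenvalue1P r A1) := simA; rewrite -unitmx_tr => uN.
set c := \sum_i v i 0.
suff : v - c *: w = 0 by move/subr0_eq=> <-.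
have Ay : A^T *m (v - c *: w) = v - c *: w by rewrite mulmxBr -scalemxAr Av Aw.
have y0 : \sum_i (v - c *: w) i 0 = 0.
  under eq_bigr => i _ do rewrite !mxE.
  by rewrite sumrB -mulr_sumr w1 mulr1 subrr.
move: (v - c *: w) Ay y0 => y /stationaryP Ay y0.
suff yN : (ones_col r (1%:M - A))^T *m y = 0.
  by rewrite -(mulKmx uN y) yN mulmx0.
apply/matrixP => j k; rewrite ord1 !mxE.
have [jr|jr] := eqVneq j r.
  by rewrite -[RHS]y0; apply: eq_bigr => i _; rewrite !mxE jr eqxx mul1r.
rewrite -[RHS](subrr (y j 0)) -{2}(Ay j).
transitivity (\sum_i ((i == j)%:R * y i 0 - A i j * y i 0)).
  by apply: eq_bigr => i _; rewrite !mxE (negPf jr) mulrBl.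
rewrite sumrB (bigD1 j) //= eqxx mul1r big1 ?addr0 // => i ij.
by rewrite (negPf ij) mul0r.
Qed.

(* The matrix with rows those of [1%:M - A] in [C] and of [1%:M] outside [C]
   kills the indicator of [C], so it also has a left kernel vector. *)
Lemma closed_stationary (R : fieldType) n (A : 'M[R]_n) (C : {pred 'I_n}) c :
  (forall i, \sum_j A i j = 1) -> c \in C ->
  (forall i j, i \in C -> A i j != 0 -> j \in C) ->
  exists v : 'cV[R]_n,
    [/\ v != 0, A^T *m v = v & forall i, i \notin C -> v i 0 = 0].
Proof.
move=> A1 cC Cclosed.
pose M : 'M[R]_n := \matrix_(i, j) ((i == j)%:R - (i \in C)%:R * A i j).
have /det0P[u u0 uM] : \det M == 0.
  rewrite -det_tr; apply/det0P; exists (\row_j (j \in C)%:R).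
    by apply/eqP => /matrixP/(_ 0 c)/eqP; rewrite !mxE cC oner_eq0.
  apply/matrixP => k i; rewrite ord1 !mxE.
  have [iC|iC] := boolP (i \in C); last first.
    apply: big1 => j _; rewrite !mxE (negPf iC) mul0r subr0.
    by case: eqVneq => [<-|_]; rewrite ?(negPf iC) ?mul0r ?mulr0.
  transitivity (\sum_j ((i == j)%:R - A i j)).
    apply: eq_bigr => j _; rewrite !mxE iC mul1r.
    have [jC|jC] := boolP (j \in C); first by rewrite mul1r.
    have -> : A i j = 0.
      by apply/eqP; apply: contraNT jC; apply: Cclosed.
    case: eqVneq jC => [<-|_ _]; first by rewrite iC.
    by rewrite mul0r subr0.
  rewrite sumrB A1 (bigD1 i) //= eqxx big1 ?addr0 ?subrr // => j ij.
  by rewrite eq_sym (negPf ij).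
have uE j : u 0 j = \sum_i (i \in C)%:R * A i j * u 0 i.
  apply/eqP; rewrite -subr_eq0; apply/eqP.
  move/matrixP/(_ 0 j): uM; rewrite !mxE => uMj; rewrite -[RHS]uMj.
  transitivity (\sum_i (u 0 i * (i == j)%:R - (i \in C)%:R * A i j * u 0 i)).
    rewrite sumrB [in RHS](bigD1 j) //= eqxx mulr1.
    rewrite [X in _ + X - _]big1 ?addr0 // => i ij.
    by rewrite (negPf ij) mulr0.
  by apply: eq_bigr => i _; rewrite !mxE mulrBr [X in _ = _ - X]mulrC.
(* No entry of [A] leads from [C] to a vertex outside it, so [uE] forces zero there. With [u]
   vanishing off [C], [uE] becomes stationarity for [A]. *)
have uC j : j \notin C -> u 0 j = 0.
  move=> jC; rewrite uE big1 // => i _.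
  have [iC|iC] := boolP (i \in C); last by rewrite !mul0r.
  have [->|Aij] := eqVneq (A i j) 0; first by rewrite mulr0 mul0r.
  by rewrite (Cclosed i j) in jC.
exists u^T; split; first by rewrite trmx_eq0.
- apply/stationaryP => j; rewrite mxE uE; apply: eq_bigr => i _; rewrite mxE.
  have [iC|iC] := boolP (i \in C); first by rewrite mul1r.
  by rewrite uC // !mulr0.
- by move=> i iC; rewrite mxE uC.
Qed.

(** The triangle inequality gives [|v| <= A^T |v|] in each coordinate, and unit row sums give both
    sides the same total, so all these inequalities are equalities. *)
Lemma stationary_norm (R : realType) n (A : 'M[R]_n) (v : 'cV[R]_n) :
  stochastic A -> A^T *m v = v -> A^T *m map_mx Num.norm v = map_mx Num.norm v.
Proof.
move=> [A0 A1] /stationaryP Av; apply/stationaryP.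
have le j : `|v j 0| <= \sum_i A i j * `|v i 0|.
  rewrite -(Av j); apply: (le_trans (ler_norm_sum _ _ _)).
  by apply: ler_sum => i _; rewrite normrM (ger0_norm (A0 i j)).
have sum0 : \sum_j (\sum_i A i j * `|v i 0| - `|v j 0|) = 0.
  rewrite sumrB exchange_big /= -sumrB big1 // => i _.
  by rewrite -mulr_suml A1 mul1r subrr.
move=> j; rewrite mxE; under eq_bigr => i _ do rewrite mxE.
apply/eqP; rewrite -subr_eq0; apply/eqP.
by apply: (psumr_eq0P _ sum0) => // k _; rewrite subr_ge0.
Qed.

Lemma stationary_support_closed (R : realType) n (A : 'M[R]_n) (v : 'cV[R]_n) i j :
  (forall i j, 0 <= A i j) -> (forall i, 0 <= v i 0) -> A^T *m v = v ->
  v i 0 != 0 -> A i j != 0 -> v j 0 != 0.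
Proof.
move=> A0 v0 /stationaryP Av vi Aij.
rewrite -Av gt_eqF // (bigD1 i) //= ltr_pwDl //.
  by rewrite mulr_gt0 // lt0r ?vi ?Aij ?v0 ?A0.
by apply: sumr_ge0 => k _; rewrite mulr_ge0.
Qed.

(** * Reachability and harmonic functions *)

Definition mx_rel {R : pzRingType} {n} (A : 'M[R]_n) : rel 'I_n :=
  fun i j => A i j != 0.

Lemma simple_connect_support (R : realType) n (A : 'M[R]_n) (w : 'cV[R]_n) i j :
  (forall i, \sum_j A i j = 1) -> simple_eigenvalue A 1 ->
  A^T *m w = w -> \sum_i w i 0 = 1 -> w j 0 != 0 -> connect (mx_rel A) i j.
Proof.
move=> A1 simA Aw w1 wj.
have [||v [v0 Av vC]] := @closed_stationary R n A (connect (mx_rel A) i) i A1.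
- exact: connect0.
- by move=> k l ik Akl; apply: connect_trans ik (connect1 _).
(* By uniqueness [v] is a multiple of [w]. If [j] were unreachable, [v j 0 = 0] with [w j 0 != 0]
   would make the factor, hence [v], zero. *)
have vE := simple_stationary_unique A1 simA Aw w1 Av.
apply: contraR v0 => /vC; rewrite vE mxE => /eqP.
by rewrite mulf_eq0 (negPf wj) orbF => /eqP ->; rewrite scale0r.
Qed.

(* The set where a harmonic function attains its maximum is closed. *)
Lemma harmonic_le (R : realType) n (A : 'M[R]_n) (x : 'I_n -> R) s :
  stochastic A -> (forall i, \sum_j A i j * x j = x i) ->
  (forall i, connect (mx_rel A) i s) -> forall i, x i <= x s.
Proof.
move=> [A0 A1] Ax cs i.
have [m _ xm] := @arg_maxP _ _ _ i xpredT x isT.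
suff <- : x m = x s by exact: xm.
have := cs m => /connectP[p pth ->].
elim: p m xm pth => //= k p IH m xm /andP[Amk pth].
(* [x m] is an average of values at most [x m], so each value of nonzero weight equals it. *)
have xmk : x m = x k.
  have sum0 : \sum_j A m j * (x m - x j) = 0.
    under eq_bigr => j _ do rewrite mulrBr.
    by rewrite sumrB -mulr_suml A1 mul1r Ax subrr.
  have /eqP : A m k * (x m - x k) = 0.
    apply: (psumr_eq0P _ sum0) => // j _.
    by rewrite mulr_ge0 // subr_ge0 xm.
  by rewrite mulf_eq0 (negPf Amk) subr_eq0 => /eqP.
by rewrite xmk IH // => j _; rewrite -xmk xm.
Qed.

Lemma harmonic_const (R : realType) n (A : 'M[R]_n) (x : 'I_n -> R) s :
  stochastic A -> (forall i, \sum_j A i j * x j = x i) ->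
  (forall i, connect (mx_rel A) i s) -> forall i, x i = x s.
Proof.
move=> stA Ax cs i; apply/le_anti.
rewrite (harmonic_le stA Ax cs) /= -lerN2.
apply: (harmonic_le (x := fun i => - x i) stA _ cs) => j.
by rewrite -Ax -sumrN; apply: eq_bigr => k _; rewrite mulrN.
Qed.

Lemma connected_simple (R : realType) n (A : 'M[R]_n) (w : 'cV[R]_n) s :
  stochastic A -> A^T *m w = w -> \sum_i w i 0 = 1 ->
  (forall i, connect (mx_rel A) i s) -> simple_eigenvalue A 1.
Proof.
move=> stA /stationaryP Aw w1 cs; have [A0 A1] := stA.
apply/(simple_eigenvalue1P s A1).
rewrite -unitmx_tr unitmxE unitfE; apply/negP => /det0P[u u0].
set N := ones_col _ _ => uN.
(* Column [s] of [N] consists of ones, so [u 0 s] enters every equation as the same constant; with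
   that coordinate zeroed, [x] is harmonic up to this constant. *)
pose x j : R := if j == s then 0 else u 0 j.
have uE i : u 0 s + x i = \sum_j A i j * x j.
  have := congr1 (fun M : 'rV_n => M 0 i) uN; rewrite !mxE => Ni.
  rewrite -[LHS]subr0 -[X in _ - X = _]Ni (bigD1 s) //= !mxE eqxx mulr1.
  rewrite opprD addrACA subrr add0r.
  transitivity (x i - \sum_j ((i == j)%:R * x j - A i j * x j)).
    congr (_ - _); rewrite [RHS](bigD1 s) //= /x eqxx !mulr0 subrr add0r.
    by apply: eq_bigr => j js; rewrite !mxE (negPf js) mulrC mulrBl.
  rewrite sumrB [X in _ - (X - _)](bigD1 i) //= eqxx mul1r big1 ?addr0.
    by rewrite subKr.
  by move=> j ij; rewrite eq_sym (negPf ij) mul0r.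
(* Pairing with the stationary [w] cancels the terms in [x] and leaves [u 0 s] times the total
   weight 1. *)
have us0 : u 0 s = 0.
  have e : \sum_i w i 0 * (u 0 s + x i) = \sum_i w i 0 * x i.
    under eq_bigr => i _ do rewrite uE mulr_sumr.
    rewrite exchange_big /=; apply: eq_bigr => j _.
    by rewrite -(Aw j) mulr_suml; apply: eq_bigr => i _; rewrite mulrCA mulrA.
  move: e; under eq_bigr => i _ do rewrite mulrDr.
  rewrite big_split /= -mulr_suml w1 mul1r => /eqP.
  by rewrite -subr_eq0 addrK => /eqP.
have xc : forall i, x i = 0.
  have xh i : \sum_j A i j * x j = x i by rewrite -uE us0 add0r.
  by move=> i; rewrite (harmonic_const stA xh cs) /x eqxx.
case/eqP: u0; apply/matrixP => k j; rewrite ord1 mxE.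
by move: (xc j); rewrite /x; case: eqVneq => [->|].
Qed.

(** * Coordinates of points of a simplex *)

Lemma simplex_coord (R : pzRingType) n (S : {set 'I_n}) (a : 'I_n -> R) k :
  (\sum_(i in S) a i *: delta_mx i 0 : 'cV[R]_n) k 0 = if k \in S then a k else 0.
Proof.
rewrite summxE; under eq_bigr => i _ do rewrite !mxE eqxx andbT.
rewrite big_mkcond (bigD1 k) //= eqxx mulr1 big1 ?addr0 // => i ik.
by rewrite eq_sym (negPf ik) mulr0 if_same.
Qed.

Lemma simplex_sum (R : pzRingType) n (S : {set 'I_n}) (w : 'cV[R]_n) :
  (forall i, i \notin S -> w i 0 = 0) -> w = \sum_(i in S) w i 0 *: delta_mx i 0.
Proof.
move=> wS; apply/matrixP => k l; rewrite ord1 simplex_coord.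
by case: ifP => // /negbT /wS.
Qed.

Lemma Sp_openP (R : realType) n (S : {set 'I_n}) (w : 'cV[R]_n) :
  Sp_open S w <->
  [/\ forall i, i \in S -> 0 < w i 0, forall i, i \notin S -> w i 0 = 0 &
      \sum_i w i 0 = 1].
Proof.
split=> [[a [a0 a1 ->]]|[w0 wS w1]].
- split=> [i iS|i iS|]; rewrite ?simplex_coord ?iS ?(negPf iS) ?a0 //.
  by under eq_bigr => i _ do rewrite simplex_coord; rewrite -big_mkcond.
- exists (fun i => w i 0); split=> //; last exact: simplex_sum.
  rewrite -w1 [RHS](bigID (mem S)) /= [X in _ + X]big1 ?addr0 //.
Qed.

Lemma Sp_closedTP (R : realType) n (w : 'cV[R]_n) :
  Sp_closed [set: 'I_n]%SET w <-> (forall i, 0 <= w i 0) /\ \sum_i w i 0 = 1.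
Proof.
split=> [[a [a0 a1 ->]]|[w0 w1]].
- split=> [i|]; first by rewrite simplex_coord inE a0 ?inE.
  by under eq_bigr => i _ do rewrite simplex_coord; rewrite -big_mkcond.
- exists (fun i => w i 0); split=> //.
    by rewrite -w1; apply: eq_bigl => i; rewrite inE.
  by apply: simplex_sum => i; rewrite inE.
Qed.

(** * Paths and walks confined to a subset *)

Lemma induced_connect (T : finType) (e : rel T) (S : {set T}) :
  (forall i j, i \in S -> e i j -> j \in S) ->
  forall i j : {x : T | x \in S}, connect e (val i) (val j) ->
  connect (@induced T e S) i j.
Proof.
move=> clS i j /connectP[p]; elim: p i => [|k p IH] i /=.
  by move=> _ /val_inj ->.
move=> /andP[eik pth] lastE.
have kS : k \in S by apply: clS eik; apply: valP.
apply: (connect_trans (y := exist _ k kS)); first exact: connect1.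
exact: IH.
Qed.

(** Removing only the edges that leave [S] makes [S] closed, while vertices outside can still enter
    it. *)
Definition trap {T : finType} (e : rel T) (S : {set T}) : rel T :=
  fun i j => e i j && ((i \in S) ==> (j \in S)).

(** A path of [e] to the root [s] is followed up to its first vertex in [S]; from there strong
    connectivity leads to [s] inside [S]. *)
Lemma trap_connect (T : finType) (e : rel T) (S : {set T}) i s :
  relevant e S -> s \in S -> connect (trap e S) i s.
Proof.
move=> [/fintype.subsetP SR scS] sS.
have inS k : k \in S -> connect (trap e S) k s.
  move=> kS; have := scS (exist _ k kS) (exist _ s sS).
  rewrite -[k in X in _ -> X]/(val (exist (fun x => x \in S) k kS)).
  rewrite -[s in X in _ -> X]/(val (exist (fun x => x \in S) s sS)).
  move=> /connectP[p pth ->]; elim: p (exist _ k kS) pth => //= l p IH m.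
  move=> /andP[eml pth]; apply: connect_trans (IH _ pth).
  by apply: connect1; rewrite /trap (valP l) implybT andbT.
have := SR _ sS; rewrite inE => /forallP/(_ i)/connectP[p pth sE].
elim: p i pth sE => [|k p IH] i /= pth sE; first by rewrite sE.
have [iS|iS] := boolP (i \in S); first exact: inS.
case/andP: pth => eik pth; apply: connect_trans (IH _ pth sE).
by apply: connect1; rewrite /trap eik (negPf iS).
Qed.

Definition uniform_walk {R : realType} {n} (e : rel 'I_n) : 'M[R]_n :=
  \matrix_(i, j) if e i j then #|e i|%:R^-1 else 0.

Lemma card_succ_gt0 (R : realType) n (e : rel 'I_n) i :
  reflexive e -> 0 < #|e i|%:R :> R.
Proof. by move=> erefl; rewrite ltr0n; apply/card_gt0P; exists i; apply: erefl. Qed.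

Lemma uniform_walk_eq0 (R : realType) n (e : rel 'I_n) i j :
  reflexive e -> (uniform_walk e i j == 0 :> R) = ~~ e i j.
Proof.
move=> erefl.
by rewrite mxE; case: (e i j); rewrite ?eqxx // invr_eq0 gt_eqF ?card_succ_gt0.
Qed.

Lemma uniform_walk_stochastic (R : realType) n (e : rel 'I_n) :
  reflexive e -> stochastic (uniform_walk e : 'M[R]_n).
Proof.
move=> erefl; split=> [i j|i].
  by rewrite mxE; case: ifP => // _; rewrite invr_ge0 ler0n.
under eq_bigr => j _ do rewrite mxE.
by rewrite -big_mkcond sumr_const -[LHS]mulr_natl divff ?gt_eqF ?card_succ_gt0.
Qed.

(** [S] is closed under [trap E S], so it carries a nonzero stationary vector. Its absolute value is
    stationary too, and a nonzero coordinate propagates along trapped paths to all of [S]. *)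
Lemma relevant_stationary (R : realType) n (E : rel 'I_n) (S : {set 'I_n}) s :
  reflexive E -> relevant E S -> s \in S ->
  exists v : 'cV[R]_n, [/\ (uniform_walk (trap E S))^T *m v = v,
    forall i, i \in S -> 0 < v i 0 & forall i, i \notin S -> v i 0 = 0].
Proof.
move=> Erefl relS sS; set e := trap E S.
have erefl : reflexive e by move=> i; rewrite /e /trap Erefl implybb.
have [P0 P1] := uniform_walk_stochastic R erefl.
have [||v [v0 Pv vS]] := @closed_stationary R n (uniform_walk e) (mem S) s P1.
- exact: sS.
- move=> i j iS; rewrite uniform_walk_eq0 // negbK => /andP[_ /implyP].
  exact.
have Pnv := stationary_norm (conj P0 P1) Pv.
exists (map_mx Num.norm v); split=> // [i iS|i iS]; last by rewrite mxE vS ?normr0.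
have [k vk] : exists k, v k 0 != 0.
  apply/existsP; apply: contraR v0 => /existsPn v0; apply/eqP/matrixP => k l.
  by rewrite ord1 mxE; apply/eqP; rewrite -[_ == _]negbK v0.
suff : map_mx Num.norm v i 0 != 0 by rewrite mxE normr_eq0 normr_gt0.
have : map_mx Num.norm v k 0 != 0 by rewrite mxE normr_eq0.
have /connectP[p pth ->] := trap_connect k relS iS.
elim: p k {vk} pth => //= l p IH k /andP[ekl pth] vk; apply: (IH _ pth).
apply: stationary_support_closed vk _ => //; first by move=> j; rewrite mxE.
by rewrite uniform_walk_eq0 // negbK.
Qed.

(** * The two inclusions *)

Lemma relevant_attainable (R : realType) n (E : rel 'I_n) (S : {set 'I_n})
    (w : 'cV[R]_n) :
  reflexive E -> relevant E S -> Sp_open S w -> graph_stochastic_at E w !=set0.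
Proof.
move=> Erefl relS /Sp_openP[w0 wS w1].
(* The empty set counts as relevant, so a vertex of [S] is obtained from [w] having sum one. *)
have [s sS] : exists s, s \in S.
  apply/set0Pn; apply: contra_eq_neq w1 => S0.
  by rewrite big1 1?eq_sym ?oner_neq0 // => i _; rewrite wS // S0 inE.
have [v [Pv v0 vS]] := relevant_stationary R Erefl relS sS.
set e := trap E S in Pv; set P := uniform_walk e in Pv.
have erefl : reflexive e by move=> i; rewrite /e /trap Erefl implybb.
have [P0 P1] : stochastic P := uniform_walk_stochastic R erefl.
(* Scaling row [i] of [P - 1] by a factor proportional to [v i / w i] on [S]
   turns the stationary weight [v] into [w]. *)
pose t i := v i 0 / w i 0.
have t0 i : i \in S -> 0 < t i by move=> iS; rewrite divr_gt0 ?v0 ?w0.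
(* The sum [T] bounds every [t i], so the speeds [d i] lie in (0, 1]: [A] is then nonnegative and
   keeps every edge of [e]. *)
pose T := \sum_(i in S) t i.
have tT i : i \in S -> t i <= T.
  move=> iS; rewrite /T (bigD1 i) //= lerDl sumr_ge0 // => j /andP[jS _].
  by rewrite ltW ?t0.
have T0 : 0 < T by apply: lt_le_trans (t0 _ sS) (tT _ sS).
pose d i := if i \in S then t i / T else 1.
have d0 i : 0 < d i by rewrite /d; case: ifP => // iS; rewrite divr_gt0 ?t0.
have d1 i : d i <= 1.
  by rewrite /d; case: ifP => // iS; rewrite ler_pdivrMr ?mul1r ?tT.
have wd i : w i 0 * d i = v i 0 / T.
  rewrite /d; case: ifP => [iS|/negbT iS]; last by rewrite wS ?vS ?mul0r.
  by rewrite mulrA /t mulrCA divff ?mulr1 ?gt_eqF ?w0.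
pose A : 'M[R]_n := \matrix_(i, j) ((1 - d i) * (i == j)%:R + d i * P i j).
have A0 i j : 0 <= A i j.
  by rewrite mxE addr_ge0 // mulr_ge0 ?subr_ge0 ?ler0n // ltW.
have A1 i : \sum_j A i j = 1.
  under eq_bigr => j _ do rewrite mxE.
  rewrite big_split /= -!mulr_sumr P1 (bigD1 i) //= eqxx big1.
    by rewrite addr0 !mulr1 subrK.
  by move=> j ji; rewrite eq_sym (negPf ji).
have Aw : A^T *m w = w.
  apply/stationaryP => j.
  transitivity (\sum_i ((i == j)%:R * w i 0 +
      (P i j * v i 0 / T - (i == j)%:R * (v i 0 / T)))).
    by apply: eq_bigr => i _; rewrite mxE -mulrA -wd; ring.
  rewrite big_split sumrB /= -mulr_suml.
  move/stationaryP: Pv => ->.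
  have delta (f : 'I_n -> R) : \sum_i (i == j)%:R * f i = f j.
    rewrite (bigD1 j) //= eqxx mul1r big1 ?addr0 // => i ij.
    by rewrite (negPf ij) mul0r.
  by rewrite !delta subrr addr0.
have Ae i j : e i j -> A i j != 0.
  move=> eij; rewrite gt_eqF // mxE ltr_wpDl //.
    by rewrite mulr_ge0 ?subr_ge0 ?ler0n.
  by rewrite mulr_gt0 // lt0r P0 uniform_walk_eq0 // negbK eij.
exists A; split=> //.
- split=> // i j Eij; rewrite mxE.
  have /eqP -> : P i j == 0 by rewrite uniform_walk_eq0 // /e /trap negb_and Eij.
  (* The identity part of [A] has weight only on the diagonal, where [E] has its self-loops. *)
  case: eqVneq Eij => [->|_ _]; first by rewrite Erefl.
  by rewrite !mulr0 addr0.
- apply: (connected_simple (s := s) (conj A0 A1) Aw w1) => i.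
  apply: connect_sub (trap_connect i relS sS) => k l ekl.
  exact/connect1/Ae.
Qed.

Lemma attainable_relevant (R : realType) n (E : rel 'I_n) (A : 'M[R]_n)
    (w : 'cV[R]_n) :
  Sp_closed [set: 'I_n]%SET w -> graph_stochastic_at E w A ->
  exists2 S : {set 'I_n}, relevant E S & Sp_open S w.
Proof.
move=> /Sp_closedTP[w0 w1] [[[A0 A1] AE] simA Aw].
have AsubE i j : mx_rel A i j -> E i j by apply: contraR => /AE ->.
pose S : {set 'I_n} := [set i | w i 0 != 0]%SET.
have cS i j : j \in S -> connect (mx_rel A) i j.
  by rewrite inE; apply: simple_connect_support.
exists S; last first.
  apply/Sp_openP; split=> // i; rewrite inE; first by rewrite lt0r w0 andbT.
  by rewrite negbK => /eqP.
split.
  apply/fintype.subsetP => j jS; rewrite inE; apply/forallP => i.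
  by apply: connect_sub (cS i j jS) => k l Akl; apply/connect1/AsubE.
(* The support [S] is closed in the graph of [A], so a path of that graph starting in [S] stays in
   the induced subgraph. *)
move=> i j; have := cS (val i) (val j) (valP j).
move=> /induced_connect cij.
apply: connect_sub (cij _) => [k l Akl|k l].
  exact/connect1/AsubE.
by rewrite !inE; apply: stationary_support_closed.
Qed.

Theorem theorem2 (R : realType) (n : nat) (E : rel 'I_n)
    (E_selfloop : forall i : 'I_n, E i i) (E_rooted : rooted E) :
  @attainable_weights R n E =
  \bigcup_(V' in [set V' : {set 'I_n} | relevant E V']) Sp_open V'.
Proof.
apply/seteqP; split=> [w [wT [A Aw]]|w [S /= relS wS]].
  by have [S relS wS] := attainable_relevant wT Aw; exists S.
split; last exact: relevant_attainable relS wS.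
have /Sp_openP[w0 wS0 w1] := wS.
apply/Sp_closedTP; split=> // i.
by have [/w0/ltW|/wS0 ->] := boolP (i \in S).
Qed.
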